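(* Let $n\ge 2$ and suppose the players' values satisfy $v_1 > v = v_2 = v_3 = \cdots = v_n > 0$. Write $n=2^s+k$ with integers $s\ge 1$ and $0\le k<2^s$. 1. If $n$ is odd, then the format that schedules $k$ matches in round $1$ and then has all remaining players competing in each subsequent round is the unique format maximizing $P_1$ among all formats for $n$ players. 2. If $n$ is even, then there is a format maximizing $P_1$ among all formats for $n$ players that schedules $n/2$ matches in round $1$.
   Context: Random knockout tournament: there are $n\ge 2$ players $1,\dots,n$ with positive values $v_1,\dots,v_n$. A format is a tuple $(r,m_1,\dots,m_r)$ of positive integers with $\sum_{s=1}^r m_s = n-1$ and $2m_s \le r_s$ for each $s$, where $r_s = n-\sum_{j=1}^{s-1} m_j$ is the number of players still alive (not eliminated) at the start of round $s$. In round $s$, independently of the past given the set of alive players, $2m_s$ of the $r_s$ alive players are chosen uniformly at random and are uniformly randomly arranged into $m_s$ match pairs. A match between $i$ and $j$ is won by $i$ with probability $v_i/(v_i+v_j)$, independently of everything else. Losers are eliminated; the winners and the alive players not chosen to play advance to the next round. After round $r$ exactly one player remains, the winner of the tournament. $P_i$ denotes the probability that player $i$ wins the tournament (it depends on the format). The format in part 1 has match numbers $k,2^{s-1},2^{s-2},\dots,1$. *)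

(* Defs.v *)
From HB Require Import structures.
From mathcomp Require Import all_boot all_order all_algebra.

Set Implicit Arguments.
Unset Strict Implicit.
Unset Printing Implicit Defensive.

Import Order.TTheory GRing.Theory Num.Theory.
Local Open Scope ring_scope.

(* Rounds are numbered from 0 here: [nth 0 f s] is the number of matches of the
   (s+1)-st round.  Under [sumn f = n - 1] the subtraction does not truncate,
   and f is nonempty as soon as n >= 2. *)
Definition alive_count (n : nat) (f : seq nat) (s : nat) : nat :=
  (n - sumn (take s f))%N.

Definition is_format (n : nat) (f : seq nat) : Prop :=
  [/\ forall s, (s < size f)%N -> (0 < nth 0 f s)%N,
      sumn f = (n - 1)%N
    & forall s, (s < size f)%N -> (2 * nth 0 f s <= alive_count n f s)%N].

(* The match numbers k, 2^(s-1), 2^(s-2), ..., 1. *)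
Definition prelim_format (k s : nat) : seq nat :=
  k :: [seq (2 ^ j)%N | j <- rev (iota 0 s)].

(* A draw seats 2m distinct players of A in the m matches, two seats per match;
   a uniform draw is a uniform choice of 2m players of A followed by a uniform
   arrangement of them into m match pairs. *)
Definition draws (n m : nat) (A : {set 'I_n}) :
    {set {ffun 'I_m * bool -> 'I_n}} :=
  [set d : {ffun 'I_m * bool -> 'I_n} |
     injectiveb d && [forall x, d x \in A]].

Definition beats (R : realFieldType) (n : nat) (v : 'I_n -> R) (i j : 'I_n) : R :=
  v i / (v i + v j).

(* Here [w q] is the seat of the winner of match q. *)
Definition losers (n m : nat) (d : {ffun 'I_m * bool -> 'I_n})
    (w : {ffun 'I_m -> bool}) : {set 'I_n} :=
  [set d (q, ~~ w q) | q : 'I_m].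

Definition outcome_prob (R : realFieldType) (n m : nat) (v : 'I_n -> R)
    (d : {ffun 'I_m * bool -> 'I_n}) (w : {ffun 'I_m -> bool}) : R :=
  \prod_(q < m) beats v (d (q, w q)) (d (q, ~~ w q)).

(* Probability that B is the set of players alive after a round of m matches
   that starts with A alive. *)
Definition round_prob (R : realFieldType) (n : nat) (v : 'I_n -> R) (m : nat)
    (A B : {set 'I_n}) : R :=
  (#|draws m A|%:R)^-1 *
  \sum_(d in draws m A)
    \sum_(w : {ffun 'I_m -> bool} | A :\: losers d w == B) outcome_prob v d w.

(* Law of the set of alive players after all the rounds of f: the Markov chain
   with the above transition probabilities, started with everyone alive. *)
Definition alive_law (R : realFieldType) (n : nat) (v : 'I_n -> R)
    (f : seq nat) : {set 'I_n} -> R :=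
  foldl (fun (mu : {set 'I_n} -> R) (m : nat) (B : {set 'I_n}) =>
           \sum_(A : {set 'I_n}) mu A * round_prob v m A B)
        (fun A => (A == [set: 'I_n])%:R) f.

Definition win_prob (R : realFieldType) (n : nat) (v : 'I_n -> R)
    (f : seq nat) (i : 'I_n) : R :=
  alive_law v f [set i].

Definition maximizes_win_prob (R : realFieldType) (n : nat) (v : 'I_n -> R)
    (i : 'I_n) (f : seq nat) : Prop :=
  is_format n f /\
  forall g : seq nat, is_format n g -> win_prob v g i <= win_prob v f i.

(* Main.v *)
Require Import Defs.
From HB Require Import structures.
From mathcomp Require Import all_boot all_order all_algebra.
From mathcomp Require Import ring lra zify.

Import Order.TTheory GRing.Theory Num.Theory.
Local Open Scope ring_scope.

(** Let c = 2 v0 / (v p1 + v0), which lies strictly between 0 and 1 and is twice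
    the probability that the strong player p1 loses a given match.  All the
    opponents are alike, so when r players are alive and m matches are
    scheduled, p1 is seated with probability 2m / r and therefore survives the
    round with probability 1 - c m / r ([sum_round_prob_survive]).  Hence the
    winning probability of p1 depends on the format only through the head
    counts n = r_0 > r_1 > ... > 1 that it produces, and equals the product of
    g(r_i, r_{i+1}), where g(a, b) = 1 - c + c b / a ([win_probE]).

    It remains to maximize this product under the constraint
    r_{i+1} >= r_i / 2.  Two exchange inequalities govern it, both immediate
    from expanding the products.  First, for d <= b < a, stopping at b on the
    way from a to d is strictly worse than going there in one step, unless
    b = d ([merge_gap]).  Second, for a / 2 <= b < 2 d <= a, going a -> b -> d
    is at most as good as going a -> 2 d -> d, with equality exactly when
    a = 2 b ([detour_gap]): this compares b / a + d / b, which is convex in b,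
    with its common value 2 d / a + 1 / 2 at b = a / 2 and b = 2 d.

    By induction on the format the maximum from r players is
    (1 - c / 2)^s g(r, 2^s), where 2^s is the largest power of 2 not exceeding
    r, and the first round of an optimal format must either lead to exactly 2^s
    players or be a full halving of r ([max_survival_step],
    [survival_max_cons]).  If r is odd only the first is possible, and from a
    power of 2 both mean halving, which gives uniqueness.  If n = 2 h is even
    then g(n, 2^s) = g(h, 2^(s-1)), so halving n and continuing with an optimal
    format for h players attains the maximum. *)

(** * The survival probability of the strong player in one round *)

(** Once the draw is fixed the matches are independent, so the sum over the
    outcomes factors into one sum for each match.  A match without p1
    contributes 1; the match in which p1 sits, if there is one, contributes the
    probability that p1 wins it. *)
Lemma sum_outcomes_survive (R : realFieldType) (n m : nat) (v : 'I_n -> R)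
    (v0 : R) (p1 : 'I_n) (d : {ffun 'I_m * bool -> 'I_n}) :
  0 < v0 -> v0 < v p1 -> (forall i, i != p1 -> v i = v0) -> injective d ->
  \sum_(w : {ffun 'I_m -> bool} | p1 \notin losers d w) outcome_prob v d w
    = if [exists x, d x == p1] then v p1 / (v p1 + v0) else 1.
Proof.
move=> hv0 hv1 hv injd.
(* Survival of p1 is a condition on each match separately, namely that the
   losing seat (q, ~~ w q) is not that of p1. *)
pose Q (q : 'I_m) : pred bool := fun b => d (q, ~~ b) != p1.
pose F (q : 'I_m) (b : bool) := beats v (d (q, b)) (d (q, ~~ b)).
rewrite (eq_bigl (mem (family Q))); last first.
  move=> w; apply/idP/familyP => [nl q | fw].
    rewrite unfold_in; apply: contra nl => /eqP e; rewrite -e.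
    by apply/imsetP; exists q.
  apply/negP => /imsetP [q _ e]; have := fw q.
  by rewrite unfold_in -e eqxx.
rewrite -(bigA_distr_big_dep Q F).
have unseated (q : 'I_m) :
    (forall b, d (q, b) != p1) -> \sum_(b | Q q b) F q b = 1.
  move=> hq; rewrite big_mkcond big_bool /= /Q /F /= !hq /beats !hv //.
  by field; lra.
have seated (q : 'I_m) (b : bool) :
    d (q, b) = p1 -> \sum_(b' | Q q b') F q b' = v p1 / (v p1 + v0).
  move=> e.
  have ne : d (q, ~~ b) != p1.
    by rewrite -e; apply/eqP => /injd []; case: (b).
  rewrite (big_pred1 b) => [|b']; last first.
    rewrite /Q /=; case: (eqVneq b' b) => [-> // | nb].
    have -> : ~~ (b' : bool) = b by move: nb; case: (b'); case: (b).
    by rewrite e eqxx.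
  by rewrite /F /beats e (hv _ ne).
case: existsP => [[[q b] /eqP e] | no].
  rewrite (bigD1 q) //= (seated _ _ e) big1 ?mulr1 // => q' nq.
  apply: unseated => b'; apply/eqP => e'.
  by move: nq; have := injd _ _ (etrans e (esym e')) => -[-> _]; rewrite eqxx.
rewrite big1 // => q _; apply: unseated => b.
by apply/negP => h; apply: no; exists (q, b).
Qed.

Lemma card_draws (n m : nat) (A : {set 'I_n}) :
  #|draws m A| = (#|A| ^_ (2 * m))%N.
Proof.
have := card_inj_ffuns_on ('I_m * bool)%type (mem A).
rewrite card_prod card_ord card_bool mulnC => <-.
apply: eq_card => d; rewrite !inE andbC; congr (_ && _).
Qed.

Lemma card_draws_avoiding (n m : nat) (A : {set 'I_n}) (x : 'I_n) :
  #|[set d in draws m A | [forall y, d y != x]]| = #|draws m (A :\ x)|.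
Proof.
apply: eq_card => d; rewrite !inE -andbA; congr (_ && _).
apply/andP/forallP => [[/forallP a /forallP b] y | a].
  by rewrite !inE b a.
by split; apply/forallP => y; have := a y; rewrite !inE => /andP [].
Qed.

(** The share of the draws that leave p1 out is
    (r - 1)^_(2m) / r^_(2m) = (r - 2m) / r, where r players are alive, because
    such draws are the draws from the other r - 1 players. *)
Lemma sum_round_prob_survive (R : realFieldType) (n m : nat) (v : 'I_n -> R)
    (v0 : R) (p1 : 'I_n) (A : {set 'I_n}) :
  0 < v0 -> v0 < v p1 -> (forall i, i != p1 -> v i = v0) ->
  p1 \in A -> (2 * m <= #|A|)%N ->
  \sum_(B : {set 'I_n} | p1 \in B) round_prob v m A B
    = 1 - 2 * v0 / (v p1 + v0) * (m%:R / #|A|%:R).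
Proof.
move=> hv0 hv1 hv pA hm; rewrite /round_prob -mulr_sumr.
set b := v p1 / (v p1 + v0).
have sum_d d : d \in draws m A ->
    \sum_(B : {set 'I_n} | p1 \in B)
      \sum_(w : {ffun 'I_m -> bool} | A :\: losers d w == B) outcome_prob v d w
    = b + (1 - b) * [forall y, d y != p1]%:R.
  rewrite inE => /andP [/injectiveP injd _].
  rewrite (exchange_big_dep (fun w : {ffun _} => p1 \notin losers d w)) /=;
    last first.
    by move=> B w pB /eqP e; move: pB; rewrite -e inE => /andP [].
  transitivity (\sum_(w : {ffun 'I_m -> bool} | p1 \notin losers d w)
                   outcome_prob v d w).
    apply: eq_bigr => w pw; rewrite (big_pred1 (A :\: losers d w)) // => B /=.
    rewrite [RHS]eq_sym andbC; case: eqP => //= <-.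
    by rewrite inE pw pA.
  rewrite (sum_outcomes_survive _ _ _ _ v0) // -/b.
  have -> : [forall y, d y != p1] = ~~ [exists y, d y == p1].
    by rewrite negb_exists.
  by case: [exists y, _] => /=; ring.
rewrite exchange_big /= (eq_bigr _ sum_d) big_split /= sumr_const.
rewrite -[b *+ _]mulr_natr -mulr_sumr -natr_sum.
have -> : (\sum_(d in draws m A) [forall y, d y != p1]
             = #|draws m (A :\ p1)|)%N.
  rewrite -card_draws_avoiding -sum1_card [RHS]big_mkcond /= [LHS]big_mkcond.
  apply: eq_bigr => d _; rewrite [in RHS]inE.
  by case: (d \in _); case: [forall y, _].
have dA_gt0 : (0 < #|draws m A|)%N by rewrite card_draws ffact_gt0.
have A_gt0 : (0 < #|A|)%N by apply/card_gt0P; exists p1.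
(* Both sides are #|A| ^_ (2 * m).+1, with the first or the last factor split
   off. *)
have ratio : (#|A| * #|draws m (A :\ p1)| = #|draws m A| * (#|A| - 2 * m))%N.
  rewrite !card_draws -ffactnSr ffactnS; congr (_ * _ ^_ _)%N.
  by have := cardsD1 p1 A; rewrite pA => ->.
have := congr1 (fun x : nat => x%:R : R) ratio.
rewrite !natrM natrB // natrM.
move: dA_gt0 A_gt0; rewrite -!(ltr0n R).
move: (#|draws m A|%:R) (#|draws m (A :\ p1)|%:R) (#|A|%:R) => D D' a D0 a0 e.
have {e} -> : D' = D * (a - 2 * m%:R) / a.
  by rewrite -e; field; lra.
by rewrite /b; field; lra.
Qed.

Lemma round_prob_neq0 {R : realFieldType} {n m : nat} {v : 'I_n -> R}
    {A B : {set 'I_n}} :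
  round_prob v m A B != 0 -> B \subset A /\ #|B| = (#|A| - m)%N.
Proof.
case: (boolP [exists d in draws m A, [exists w : {ffun 'I_m -> bool},
    A :\: losers d w == B]]) => [| no]; last first.
  rewrite /round_prob big1 ?mulr0 ?eqxx // => d dA; rewrite big_pred0 // => w.
  apply/negbTE/negP => h; case/negP: no.
  by apply/exists_inP; exists d => //; apply/existsP; exists w.
case/exists_inP => d; rewrite inE => /andP [/injectiveP injd /forallP dA].
case/existsP => w /eqP <- _; split; first exact: subsetDl.
have sub : losers d w \subset A by apply/subsetP => x /imsetP [q _ ->].
rewrite cardsD (setIidPr sub) card_imset ?card_ord //.
by move=> q q' /injd [].
Qed.

(** * The winning probability as a product over the rounds *)

(** The factor of a round played by [r] players with [m] matches is the chance
    that the distinguished player is not eliminated in it, so this product is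
    the chance that this player survives all the rounds of [f]. *)
Fixpoint survival {R : realFieldType} (c : R) (r : nat) (f : seq nat) : R :=
  if f is m :: f' then (1 - c * (m%:R / r%:R)) * survival c (r - m) f' else 1.

(** The recursive form of being a format for [r] players: it passes from a
    format to its tail, as inductions over the rounds require. *)
Fixpoint playable (r : nat) (f : seq nat) : bool :=
  if f is m :: f' then [&& (0 < m)%N, (2 * m <= r)%N & playable (r - m) f']
  else r == 1.

Lemma is_formatP (n : nat) (f : seq nat) :
  (0 < n)%N -> is_format n f <-> playable n f.
Proof.
elim: f n => [|m f IH] n n0 /=.
  rewrite /is_format /=; split => [[_ h _] | /eqP ->]; last by split.
  by apply/eqP; lia.
split => [[pos tot fit] | /and3P [m0 mn pf]].
  have m0 := pos 0 isT; have := fit 0 isT; rewrite /alive_count /= in m0 *.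
  rewrite subn0 => mn; rewrite m0 mn /=; apply/(IH (n - m)%N); first by lia.
  split; first by move=> s hs; apply: (pos s.+1).
    by rewrite /= in tot; lia.
  move=> s hs; have := fit s.+1 hs; rewrite /alive_count /=; lia.
have nm0 : (0 < n - m)%N by lia.
have [pos tot fit] := (IH _ nm0).2 pf.
split; first by case=> [|s] //=; apply: pos.
  by rewrite /=; lia.
case=> [|s] hs; rewrite /alive_count /=; first by rewrite subn0.
by have := fit s hs; rewrite /alive_count; lia.
Qed.

(** The initial law [mu] is arbitrary so that the induction can absorb the first
    round into it.  Only the alive sets that contain p1 need to have the
    prescribed size: the others never lead back to a set containing p1.  At the
    end one player is alive, so [[set p1]] carries all the mass of the sets that
    contain p1. *)
Lemma sum_rounds_survive (R : realFieldType) (n : nat) (v : 'I_n -> R)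
    (v0 : R) (p1 : 'I_n) (f : seq nat) (r : nat) (mu : {set 'I_n} -> R) :
  0 < v0 -> v0 < v p1 -> (forall i, i != p1 -> v i = v0) ->
  playable r f ->
  (forall A : {set 'I_n}, p1 \in A -> mu A != 0 -> #|A| = r) ->
  foldl (fun (mu : {set 'I_n} -> R) (m : nat) (B : {set 'I_n}) =>
           \sum_(A : {set 'I_n}) mu A * round_prob v m A B) mu f [set p1]
    = survival (2 * v0 / (v p1 + v0)) r f
        * \sum_(A : {set 'I_n} | p1 \in A) mu A.
Proof.
move=> hv0 hv1 hv; elim: f r mu => [|m f IH] r mu /=.
  move=> /eqP -> supp; rewrite mul1r (bigD1 [set p1]) ?set11 //= big1 ?addr0 //.
  move=> A /andP [pA nA]; apply/eqP; apply: contraNT nA => nz.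
  by rewrite eq_sym eqEcard sub1set pA cards1 (supp A pA nz).
case/and3P => m0 mr pf supp.
rewrite (IH (r - m)%N) //; last first.
  move=> B pB nz.
  have [A /andP [nzA nzAB]] : exists A,
      (mu A != 0) && (round_prob v m A B != 0).
    apply/existsP; apply: contraNT nz; rewrite negb_exists => /forallP no.
    rewrite big1 // => A _; have := no A; rewrite negb_and !negbK.
    by case/orP => /eqP ->; rewrite ?mul0r ?mulr0.
  have [BA ->] := round_prob_neq0 nzAB.
  by rewrite (supp A) // (subsetP BA).
rewrite exchange_big /= [X in _ = X * _]mulrC -[RHS]mulrA; congr (_ * _).
rewrite mulr_sumr [RHS]big_mkcond; apply: eq_bigr => A _.
rewrite -mulr_sumr; case: ifP => pA; last first.
  rewrite big1 ?mulr0 // => B pB; apply/eqP; apply: contraFT pA.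
  by case/round_prob_neq0 => /subsetP BA _; apply: BA.
case: (eqVneq (mu A) 0) => [-> | nz]; first by rewrite mul0r mulr0.
rewrite -(supp A pA nz) in mr *.
by rewrite (sum_round_prob_survive _ _ _ _ v0) // mulrC.
Qed.

Lemma win_probE (R : realFieldType) (n : nat) (v : 'I_n -> R)
    (v0 : R) (p1 : 'I_n) (f : seq nat) :
  0 < v0 -> v0 < v p1 -> (forall i, i != p1 -> v i = v0) ->
  playable n f ->
  win_prob v f p1 = survival (2 * v0 / (v p1 + v0)) n f.
Proof.
move=> hv0 hv1 hv pf; rewrite /win_prob /alive_law.
rewrite (sum_rounds_survive _ _ _ v0 _ _ n) //; last first.
  move=> A _ /=; case: (eqVneq A) => [-> _ | _]; rewrite ?eqxx //.
  by rewrite cardsT card_ord.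
rewrite (bigD1 setT) ?inE //= eqxx big1 ?addr0 ?mulr1 //.
by move=> A /andP [_ nA]; rewrite (negbTE nA).
Qed.

(** * Full halving from a power of 2 *)

Lemma natr_div_double {R : realFieldType} (h : nat) :
  (0 < h)%N -> h%:R / (2 * h)%:R = 2^-1 :> R.
Proof. by rewrite -(ltr0n R) natrM => h0; field; lra. Qed.

Definition halvings (s : nat) : seq nat :=
  [seq (2 ^ j)%N | j <- rev (iota 0 s)].

Lemma halvingsS (s : nat) : halvings s.+1 = (2 ^ s)%N :: halvings s.
Proof. by rewrite /halvings -(addn1 s) iotaD rev_cat. Qed.

Lemma playable_halvings (s : nat) : playable (2 ^ s) (halvings s).
Proof.
elim: s => [|s IH] //; rewrite halvingsS /= expn_gt0 expnS leqnn /=.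
by have -> : (2 * 2 ^ s - 2 ^ s = 2 ^ s)%N by lia.
Qed.

Lemma survival_halvings (R : realFieldType) (c : R) (s : nat) :
  survival c (2 ^ s) (halvings s) = (1 - c / 2) ^+ s.
Proof.
elim: s => [|s IH]; first by [].
rewrite halvingsS /= exprS -IH expnS.
have -> : (2 * 2 ^ s - 2 ^ s = 2 ^ s)%N by lia.
by rewrite natr_div_double ?expn_gt0.
Qed.

(** * The two exchange inequalities and the optimal value *)

(** The value of the format that first reduces [r] players to the largest power
    of 2 not exceeding [r] and then halves. *)
Definition max_survival {R : realFieldType} (c : R) (r : nat) : R :=
  let s := trunc_log 2 r in
  (1 - c / 2) ^+ s * (1 - c + c * ((2 ^ s)%:R / r%:R)).

Lemma max_survivalE (R : realFieldType) (c : R) (s r : nat) :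
  (2 ^ s <= r < 2 ^ s.+1)%N ->
  max_survival c r = (1 - c / 2) ^+ s * (1 - c + c * ((2 ^ s)%:R / r%:R)).
Proof. by move=> h; rewrite /max_survival (trunc_log_eq (ltnSn 1) h). Qed.

(** With x = b / a and y = d / b the gap is c (1 - c) (1 - x) (1 - y), so it
    vanishes only when one of the two rounds eliminates nobody. *)
Lemma merge_gap (R : realFieldType) (c a b d : R) :
  0 < c -> c < 1 -> 0 < d -> d <= b -> b < a ->
  let g x y := 1 - c + c * (y / x) in
  g a b * g b d <= g a d ?= iff (b == d).
Proof.
move=> c0 c1 d0 db ba g.
have -> : g a b * g b d = g a d - c * (1 - c) * ((a - b) * (b - d)) / (a * b).
  by rewrite /g; field; lra.
case: (eqVneq b d) => [-> | nbd].
  by rewrite subrr mulr0 mulr0 mul0r subr0; apply/leif_refl.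
have lt : 0 < c * (1 - c) * ((a - b) * (b - d)) / (a * b).
  have db' : d < b by rewrite lt_neqAle eq_sym nbd.
  by apply: divr_gt0; repeat apply: mulr_gt0; lra.
by split; [lra | apply/negbTE/eqP; lra].
Qed.

(** For fixed a and d the product depends on b only through b / a + d / b, which
    is convex in b and takes the same value at b = a / 2 and at b = 2 d. *)
Lemma detour_gap (R : realFieldType) (c a b d : R) :
  0 < c -> c < 1 -> 0 < d -> a <= 2 * b -> b < 2 * d -> 2 * d <= a ->
  let g x y := 1 - c + c * (y / x) in
  g a b * g b d <= g a (2 * d) * g (2 * d) d ?= iff (a == 2 * b).
Proof.
move=> c0 c1 d0 ab bd da g.
have -> : g a b * g b d = g a (2 * d) * g (2 * d) d
    - c * (1 - c) * ((2 * d - b) * (2 * b - a)) / (2 * a * b).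
  by rewrite /g; field; lra.
case: (eqVneq a (2 * b)) => [-> | nab].
  by rewrite subrr mulr0 mulr0 mul0r subr0; apply/leif_refl.
have lt : 0 < c * (1 - c) * ((2 * d - b) * (2 * b - a)) / (2 * a * b).
  have ab' : a < 2 * b by rewrite lt_neqAle nab.
  by apply: divr_gt0; repeat apply: mulr_gt0; lra.
by split; [lra | apply/negbTE/eqP; lra].
Qed.

(** If the round ends above the power of 2 below [r], the best continuation
    passes through that power and [merge_gap] applies.  If it ends below, the
    best continuation passes through the preceding power of 2, and [detour_gap]
    applies with this preceding power as d. *)
Lemma max_survival_step {R : realFieldType} {c : R} (r m : nat) :
  0 < c -> c < 1 -> (0 < m)%N -> (2 * m <= r)%N ->
  (1 - c * (m%:R / r%:R)) * max_survival c (r - m) <= max_survival c r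
    ?= iff ((r - m)%N == 2 ^ trunc_log 2 r)%N || (r == 2 * m)%N.
Proof.
move=> c0 c1 m0 mr.
set s := trunc_log 2 r; set b := (r - m)%N.
have r0 : (0 < r)%N by lia.
have /andP [sr rs] : (2 ^ s <= r < 2 ^ s.+1)%N by apply: trunc_log_bounds.
have stepE : 1 - c * (m%:R / r%:R) = 1 - c + c * (b%:R / r%:R) :> R.
  rewrite natrB; last by lia.
  by have : (0 < r%:R :> R); [rewrite ltr0n | move=> ?; field; lra].
have p0 : 0 < 1 - c / 2 by lra.
have br : (b < r)%N by rewrite /b; lia.
have rb : (r <= 2 * b)%N by rewrite /b; lia.
have brR : b%:R < r%:R :> R by rewrite ltr_nat.
rewrite stepE (max_survivalE _ c s r); last by rewrite sr rs.
case: (leqP (2 ^ s) b) => [sb | bs].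
  rewrite (max_survivalE _ c s b); last by rewrite sb (ltn_trans br).
  (* Half of r < 2 ^ s.+1 is below 2 ^ s, so this round is not a halving. *)
  have -> : (b == 2 ^ s)%N || (r == 2 * m)%N = (b == 2 ^ s)%N.
    apply/orb_idr => /eqP rm; rewrite expnS in rs; rewrite /b in sb *.
    by apply/eqP; lia.
  have d0 : 0 < (2 ^ s)%:R :> R by rewrite ltr0n expn_gt0.
  have dbR : (2 ^ s)%:R <= b%:R :> R by rewrite ler_nat.
  rewrite mulrCA -(eqr_nat R).
  have [le eqc] := merge_gap _ _ _ _ _ c0 c1 d0 dbR brR.
  split; first by rewrite ler_pM2l ?exprn_gt0.
  by rewrite (inj_eq (mulfI _)) ?lt0r_neq0 ?exprn_gt0.
case: s => [|s] in sr rs bs *.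
  by move: bs rb; rewrite expn0; lia.
rewrite !expnS in sr rs bs *.
rewrite (max_survivalE _ c s b); last by rewrite expnS; apply/andP; split; lia.
have -> : (b == 2 * 2 ^ s)%N || (r == 2 * m)%N = (r == 2 * b)%N.
  rewrite /b in bs *; apply/idP/idP => [/orP [] | ] /eqP h; first by lia.
    by apply/eqP; lia.
  by apply/orP; right; apply/eqP; lia.
have d0 : 0 < (2 ^ s)%:R :> R by rewrite ltr0n expn_gt0.
have [] := detour_gap R c r%:R b%:R (2 ^ s)%:R c0 c1 d0.
- by rewrite -natrM ler_nat.
- by rewrite -natrM ltr_nat.
- by rewrite -natrM ler_nat.
rewrite -!natrM eqr_nat => le eqc.
have halfE : 1 - c + c * ((2 ^ s)%:R / (2 * 2 ^ s)%:R) = 1 - c / 2.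
  by rewrite natr_div_double ?expn_gt0 //; lra.
rewrite halfE in le eqc.
rewrite mulrCA exprSr -mulrA [X in _ <= _ * X ?= iff _]mulrC.
split; first by rewrite ler_pM2l ?exprn_gt0.
by rewrite (inj_eq (mulfI _)) ?lt0r_neq0 ?exprn_gt0.
Qed.

(** * Optimal formats *)

Lemma survival_le {R : realFieldType} {c : R} (r : nat) (f : seq nat) :
  0 < c -> c < 1 -> (0 < r)%N -> playable r f ->
  survival c r f <= max_survival c r.
Proof.
move=> c0 c1; elim: f r => [|m f IH] r r0 /=.
  move/eqP => ->; rewrite (max_survivalE _ c 0) //.
  by rewrite expr0 mul1r expn0 divr1 mulr1 subrK.
case/and3P => m0 mr pf.
apply: le_trans (max_survival_step r m c0 c1 m0 mr).1.
apply: ler_wpM2l; last by apply: IH => //; lia.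
have : m%:R / r%:R <= 1 :> R.
  by rewrite ler_pdivrMr ?mul1r ?ler_nat ?ltr0n //; lia.
have : 0 <= m%:R / r%:R :> R by apply: divr_ge0.
by move: (_ / _) => x x0 x1; nra.
Qed.

(** An optimal format loses nothing at its first step and continues
    optimally. *)
Lemma survival_max_cons {R : realFieldType} {c : R} (r m : nat) (f : seq nat) :
  0 < c -> c < 1 -> playable r (m :: f) ->
  survival c r (m :: f) = max_survival c r ->
  ((r - m)%N == 2 ^ trunc_log 2 r)%N || (r == 2 * m)%N /\
  survival c (r - m) f = max_survival c (r - m).
Proof.
move=> c0 c1 /= /and3P [m0 mr pf] e.
have [le <-] := max_survival_step r m c0 c1 m0 mr.
have lef : survival c (r - m) f <= max_survival c (r - m).
  by apply: survival_le => //; lia.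
have g0 : 0 < 1 - c * (m%:R / r%:R).
  have : m%:R / r%:R <= 1 :> R.
    by rewrite ler_pdivrMr ?mul1r ?ler_nat ?ltr0n //; lia.
  have : 0 <= m%:R / r%:R :> R by apply: divr_ge0.
  by move: (_ / _) => x x0 x1; nra.
have eqf : survival c (r - m) f = max_survival c (r - m).
  by apply/eqP; rewrite eq_le lef /= -(ler_pM2l g0) e.
by split; [rewrite -eqf e | ].
Qed.

(** A round starting from 2^s players plays at least one match, so it cannot end
    with 2^s players, and an optimal first round is a halving. *)
Lemma survival_max_pow2 {R : realFieldType} {c : R} (s : nat) (f : seq nat) :
  0 < c -> c < 1 -> playable (2 ^ s) f ->
  survival c (2 ^ s) f = max_survival c (2 ^ s) -> f = halvings s.
Proof.
move=> c0 c1; elim: s f => [|s IH] [|m f] //.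
- by rewrite /= expn0 => /and3P [m0 m1 _]; lia.
- by rewrite /= => /eqP h; have := expn_gt0 2 s; rewrite expnS in h; lia.
move=> pf /(survival_max_cons _ _ _ c0 c1 pf) [].
rewrite trunc_expnK //; case/and3P: pf => m0 mr pf h e.
have mE : m = (2 ^ s)%N by move: h; rewrite expnS in mr *; lia.
have half : (2 ^ s.+1 - m = 2 ^ s)%N by rewrite mE expnS; lia.
by rewrite half in pf e; rewrite (IH _ pf e) halvingsS mE.
Qed.

Lemma playable_prelim (k s : nat) :
  (0 < k)%N -> (k <= 2 ^ s)%N -> playable (2 ^ s + k) (prelim_format k s).
Proof.
move=> k0 ks; rewrite /= k0 addnK playable_halvings andbT /=; lia.
Qed.

Lemma survival_prelim {R : realFieldType} {c : R} (k s : nat) :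
  (k < 2 ^ s)%N ->
  survival c (2 ^ s + k) (prelim_format k s) = max_survival c (2 ^ s + k).
Proof.
move=> ks; rewrite (max_survivalE _ c s); last first.
  by rewrite expnS; apply/andP; split; lia.
rewrite /= addnK survival_halvings mulrC; congr (_ * _).
have : 0 < (2 ^ s + k)%:R :> R by rewrite ltr0n addn_gt0 expn_gt0.
by rewrite natrD => r0; field; lra.
Qed.

(** Doubling [r] also doubles the power of 2 below it, so their ratio is
    unchanged and only the exponent of 1 - c / 2 grows. *)
Lemma max_survival_double {R : realFieldType} {c : R} (r : nat) :
  (0 < r)%N -> max_survival c (2 * r) = (1 - c / 2) * max_survival c r.
Proof.
move=> r0; rewrite /max_survival trunc_logMp // exprS -mulrA expnS !natrM.
by rewrite -mulf_div divff ?mul1r ?pnatr_eq0.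
Qed.

Lemma maximizes_of_survival (R : realFieldType) (n : nat) (v : 'I_n -> R)
    (v0 : R) (p1 : 'I_n) (f : seq nat) (c := 2 * v0 / (v p1 + v0)) :
  0 < v0 -> v0 < v p1 -> (forall i, i != p1 -> v i = v0) ->
  playable n f -> survival c n f = max_survival c n ->
  maximizes_win_prob v p1 f /\
  forall g, maximizes_win_prob v p1 g ->
    playable n g /\ survival c n g = max_survival c n.
Proof.
move=> hv0 hv1 hv pf sf.
have n0 : (0 < n)%N := leq_ltn_trans (leq0n p1) (ltn_ord p1).
have c0 : 0 < c by rewrite /c; apply: divr_gt0; lra.
have c1 : c < 1 by rewrite /c ltr_pdivrMr; lra.
split.
  split=> [|g /(is_formatP _ _ n0) pg]; first exact/is_formatP.
  by rewrite !(win_probE _ _ _ v0) // -/c sf survival_le.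
move=> g [/(is_formatP _ _ n0) pg gmax]; split=> //.
apply/eqP; rewrite eq_le survival_le //= -sf.
by have := gmax f ((is_formatP _ _ n0).2 pf); rewrite !(win_probE _ _ _ v0).
Qed.

Theorem mainTheorem9 (R : realFieldType) (n : nat) (hn : (2 <= n)%N)
  (v : 'I_n -> R) (v0 : R) (p1 : 'I_n) (hp1 : nat_of_ord p1 = 0%N)
  (hv0 : 0 < v0) (hv1 : v0 < v p1) (hv : forall i : 'I_n, i != p1 -> v i = v0)
  (s k : nat) (hs : (1 <= s)%N) (hk : (k < 2 ^ s)%N) (hnsk : n = (2 ^ s + k)%N) :
  (odd n ->
     maximizes_win_prob v p1 (prelim_format k s) /\
     forall f : seq nat, maximizes_win_prob v p1 f -> f = prelim_format k s)
  /\
  (~~ odd n ->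
     exists f : seq nat,
       maximizes_win_prob v p1 f /\ nth 0%N f 0 = (n %/ 2)%N).
Proof.
set c : R := 2 * v0 / (v p1 + v0).
have c0 : 0 < c by rewrite /c; apply: divr_gt0; lra.
have c1 : c < 1 by rewrite /c ltr_pdivrMr; lra.
split=> [n_odd | n_even].
  have k0 : (0 < k)%N.
    rewrite lt0n; apply/eqP => k0; move: n_odd.
    by rewrite hnsk k0 addn0 oddX orbF; lia.
  have pf : playable n (prelim_format k s).
    by rewrite hnsk; apply: playable_prelim => //; exact: ltnW.
  have sf : survival c n (prelim_format k s) = max_survival c n.
    by rewrite [X in survival c X]hnsk survival_prelim // -hnsk.
  have [fmax uniq_max] := maximizes_of_survival _ _ _ _ _ _ hv0 hv1 hv pf sf.
  split=> // f /uniq_max [] {pf sf fmax uniq_max}.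
  case: f => [|m f] pf; first by move: pf => /= /eqP n1; rewrite n1 in hn.
  move=> /(survival_max_cons _ _ _ c0 c1 pf) [].
  have -> : trunc_log 2 n = s.
    by apply: trunc_log_eq => //; rewrite hnsk expnS; lia.
  case/and3P: pf => m0 mn pf h e.
  have nm : (n - m = 2 ^ s)%N.
    by case/orP: h => /eqP // nm; move: n_odd; rewrite nm oddM.
  rewrite nm in pf e; rewrite (survival_max_pow2 _ _ c0 c1 pf e).
  by congr (_ :: _); lia.
have [f pf [sf f0]] : exists2 f, playable n f &
    survival c n f = max_survival c n /\ nth 0%N f 0 = (n %/ 2)%N.
  have [h nE] : exists h, n = (2 * h)%N by exists n./2; lia.
  have [g [pg sg]] : exists g,
      playable h g /\ survival c h g = max_survival c h.
    (* Here 2 ^ (s - 1) <= h < 2 ^ s; if h is a power of 2 the preliminary round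
       would have no match and has to be left out. *)
    case: s hs hk hnsk => // s _; rewrite expnS => hk hnsk.
    have hE : h = (2 ^ s + k./2)%N by lia.
    case: (posnP k) => [k0 | k0].
      exists (halvings s); rewrite hE k0 addn0; split.
        exact: playable_halvings.
      rewrite survival_halvings (max_survivalE _ c s); last first.
        by rewrite leqnn ltn_exp2l ?ltnSn.
      by rewrite divff ?pnatr_eq0 -?lt0n ?expn_gt0 // mulr1 subrK mulr1.
    exists (prelim_format k./2 s); rewrite hE; split.
      by apply: playable_prelim; lia.
    by apply: survival_prelim; lia.
  have h0 : (0 < h)%N by lia.
  have hh : (2 * h - h = h)%N by lia.
  exists (h :: g); first by rewrite /= nE hh pg h0 leqnn.
  split; last by rewrite nE /=; lia.
  by rewrite [LHS]/= nE hh sg max_survival_double // natr_div_double.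
exists f; split=> //.
by have [] := maximizes_of_survival _ _ _ _ _ _ hv0 hv1 hv pf sf.
Qed.
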